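(* Let $0<p<1$ and let $L(n)$ be the length of the longest success run in the first $n$ of a sequence of i.i.d. Bernoulli($p$) trials. Define $$\Lambda^*(x)=\begin{cases}+\infty, & x<1,\\ (x-1)\ln(1/p), & x\ge 1.\end{cases}$$ Then $L(n)/\log_{1/p} n$ satisfies a large deviation principle with good rate function $\Lambda^*$ and speed $\log_{1/p} n$. Namely: (i) for any open set $O\subset\mathbb{R}$, $$\liminf_{n\to\infty}\frac{1}{\log_{1/p} n}\ln\mathbb{P}\left(\frac{L(n)}{\log_{1/p} n}\in O\right)\ge -\inf_{x\in O}\Lambda^*(x);$$ (ii) for any closed set $F\subset\mathbb{R}$, $$\limsup_{n\to\infty}\frac{1}{\log_{1/p} n}\ln\mathbb{P}\left(\frac{L(n)}{\log_{1/p} n}\in F\right)\le -\inf_{x\in F}\Lambda^*(x).$$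
   Context: $X_1,X_2,\ldots$ are i.i.d. with $\mathbb{P}(X_i=1)=p$, $\mathbb{P}(X_i=0)=1-p$. For $n\ge 1$, $L(n)$ is the largest integer $\ell\ge 0$ such that $X_{i+1}+\cdots+X_{i+\ell}=\ell$ for some $0\le i\le n-\ell$. $\ln$ is the natural logarithm and $\log_{1/p}$ is the logarithm with base $1/p$. A good rate function is a lower semicontinuous function with values in $[0,\infty]$ whose sublevel sets $\{x:\Lambda^*(x)\le c\}$, $c\ge 0$, are compact. Conventions: $\ln 0=-\infty$, $\inf\emptyset=+\infty$. *)

(* Defs.v *)
From HB Require Import structures.
From mathcomp Require Import all_boot all_order all_algebra finmap.
From mathcomp Require Import all_classical all_reals all_analysis.

Set Implicit Arguments.
Unset Strict Implicit.
Unset Printing Implicit Defensive.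

Import Order.TTheory GRing.Theory Num.Theory.
Import numFieldNormedType.Exports.

Local Open Scope classical_set_scope.
Local Open Scope ring_scope.

Definition mutually_independent (d : measure_display) (T : measurableType d)
    (R : realType) (P : probability T R) (X : nat -> {RV P >-> R}) : Prop :=
  forall (J : {fset nat}) (A : nat -> set R),
    (forall i, measurable (A i)) ->
    P (\bigcap_(i in [set` J]) (X i @^-1` A i)) =
      (\prod_(i <- J) P (X i @^-1` A i))%E.

(* The two point masses add up to 1, so they determine the common law. *)
Definition iid_bernoulli (d : measure_display) (T : measurableType d)
    (R : realType) (P : probability T R) (p : R)
    (X : nat -> {RV P >-> R}) : Prop :=
  mutually_independent X /\
  forall i, P (X i @^-1` [set 1]) = p%:E /\ P (X i @^-1` [set 0]) = (1 - p)%:E.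

(* The sequence is indexed from 0: [X k] is the trial number k + 1, so the sum
   below is X_(i+1) + ... + X_(i+l) in the usual numbering.  The value l = 0
   always qualifies, hence the maximum is attained. *)
Definition longest_run (T : Type) (R : realType) (X : nat -> T -> R)
    (n : nat) (w : T) : nat :=
  \max_(l < n.+1 |
        [exists i : 'I_n.+1, (i <= n - l)%N &&
           (\sum_(i <= k < i + l) X k w == l%:R)]) l.

Definition logb (R : realType) (b x : R) : R := ln x / ln b.

Definition good_rate_function (R : realType) (I : R -> \bar R) : Prop :=
  [/\ forall x, (0 <= I x)%E,
      lower_semicontinuous I
    & forall c : R, 0 <= c -> compact [set x | (I x <= c%:E)%E]].

(* [lne] is the extended logarithm, with [lne 0 = -oo], and
   [ereal_inf set0 = +oo]. *)
Definition satisfies_LDP (d : measure_display) (T : measurableType d)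
    (R : realType) (P : probability T R) (Z : nat -> T -> R)
    (speed : nat -> R) (I : R -> \bar R) : Prop :=
  [/\ good_rate_function I,
      forall O : set R, open O ->
        (- ereal_inf (I @` O) <=
         limn_einf (fun n => ((speed n)^-1)%:E * lne (P (Z n @^-1` O))))%E
    & forall F : set R, closed F ->
        (limn_esup (fun n => ((speed n)^-1)%:E * lne (P (Z n @^-1` F))) <=
         - ereal_inf (I @` F))%E].

Definition run_rate (R : realType) (p : R) (x : R) : \bar R :=
  if x < 1 then +oo%E else ((x - 1) * ln (1 / p))%:E.

(* Main.v *)
(** Write l(n) = log_{1/p} n, so that p ^ (x l(n)) = n ^ (- x).

    A run of length k starts at one of at most n + 1 places, hence
    P(L(n) >= k) <= (n + 1) p ^ k by the union bound; for k close to y l(n)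
    this is of order n ^ (1 - y).  Cutting the first n trials into
    m = n / k disjoint blocks of length k gives P(L(n) < k) <= (1 - p ^ k) ^ m.
    For k close to (1 - e) l(n) the right-hand side is at most
    exp (- n ^ e / O(log n)), which beats every power of n, so only the upper
    tail matters for closed sets.  For k close to x l(n) with x >= 1 one has
    m p ^ k <= 1, so (1 - p ^ k) ^ m <= 1 / (1 + m p ^ k) <= 1 - m p ^ k / 2
    and P(L(n) >= k) is at least of order n ^ (1 - x) / log n; the union bound
    for slightly larger k is negligible against it, so L(n) / l(n) falls just
    above x with the probability needed for open sets. *)

Require Import Defs.
From HB Require Import structures.
From mathcomp Require Import all_boot all_order all_algebra finmap.
From mathcomp Require Import all_classical all_reals all_analysis.
From mathcomp Require Import ring lra zify.

Set Implicit Arguments.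
Unset Strict Implicit.
Unset Printing Implicit Defensive.

Import Order.TTheory GRing.Theory Num.Theory.
Import numFieldNormedType.Exports.

Local Open Scope classical_set_scope.
Local Open Scope ring_scope.


(** * Full blocks of successes and their probabilities *)

Definition all_success (R : realType) (T : Type) (X : nat -> T -> R)
    (J : {fset nat}) : set T :=
  \bigcap_(i in [set` J]) (X i @^-1` [set 1]).

Definition window (a k : nat) : {fset nat} := [fset i in iota a k]%fset.

Definition no_full_block (R : realType) (T : Type) (X : nat -> T -> R)
    (k m : nat) : set T :=
  \big[setI/setT]_(j < m) ~` all_success X (window (j * k) k).

Lemma in_window (a k i : nat) : (i \in window a k) = (a <= i < a + k)%N.
Proof. by rewrite in_fset /= mem_iota. Qed.

Lemma card_window (a k : nat) : #|` window a k| = k.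
Proof. by rewrite card_fseq undup_id ?iota_uniq// size_iota. Qed.

Lemma all_successU (R : realType) (T : Type) (X : nat -> T -> R)
    (J K : {fset nat}) :
  all_success X (J `|` K)%fset = all_success X J `&` all_success X K.
Proof. by rewrite /all_success set_fsetU bigcap_setU. Qed.

Lemma measurable_all_success (d : measure_display) (T : measurableType d)
    (R : realType) (P : probability T R) (X : nat -> {RV P >-> R})
    (J : {fset nat}) : measurable (all_success X J).
Proof.
apply: fin_bigcap_measurable => [|i _]; first exact: finite_fset.
by rewrite -[X in measurable X]setTI; exact: measurable_funP.
Qed.

Lemma measurable_no_full_block (d : measure_display) (T : measurableType d)
    (R : realType) (P : probability T R) (X : nat -> {RV P >-> R})
    (k m : nat) : measurable (no_full_block X k m).
Proof.
apply: bigsetI_measurable => j _.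
by apply: measurableC; exact: measurable_all_success.
Qed.

Lemma prob_all_success (d : measure_display) (T : measurableType d)
    (R : realType) (P : probability T R) (p : R)
    (X : nat -> {RV P >-> R}) (hX : iid_bernoulli p X) (J : {fset nat}) :
  P (all_success X J) = (p ^+ #|` J|)%:E.
Proof.
case: hX => ind law.
rewrite /all_success (ind J (fun=> [set 1]))//.
rewrite (eq_bigr (fun=> p%:E)) => [|i _]; last by case: (law i).
by rewrite big_const_seq count_predT -Monoid.iteropE /= EFin_expe.
Qed.

(* The extra trials in J make the induction on m self-contained: removing the
   event that the last block is full subtracts the same expression with that
   block added to J. *)
Lemma prob_no_full_block_all_success (d : measure_display)
    (T : measurableType d) (R : realType) (P : probability T R) (p : R)
    (X : nat -> {RV P >-> R}) (hX : iid_bernoulli p X) (k m : nat)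
    (J : {fset nat}) : (forall i, i \in J -> m * k <= i)%N ->
  P (no_full_block X k m `&` all_success X J) =
  ((1 - p ^+ k) ^+ m * p ^+ #|` J|)%:E.
Proof.
elim: m J => [|m IH] J HJ.
  by rewrite /no_full_block big_ord0 setTI (prob_all_success hX) expr0 mul1r.
rewrite /no_full_block big_ord_recr/= -/(no_full_block X k m).
set W := window (m * k) k.
have -> : no_full_block X k m `&` ~` all_success X W `&` all_success X J =
   (no_full_block X k m `&` all_success X J) `\` all_success X W.
  by rewrite setDE setIAC.
have mN := measurable_no_full_block X k m.
have mJ := measurable_all_success X J.
have mW := measurable_all_success X W.
rewrite measureD//; last 2 first.
- exact: measurableI.
- by rewrite ltey_eq fin_num_measure//; exact: measurableI.
rewrite -setIA -all_successU.
transitivity (((1 - p ^+ k) ^+ m * p ^+ #|` J|)%:E -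
  ((1 - p ^+ k) ^+ m * p ^+ #|` (J `|` W)%fset|)%:E)%E.
  (* Both index sets satisfy the weaker hypothesis for m: [J] lies at or beyond (m + 1) k, and [W]
     starts at m k. *)
  congr (_ - _)%E; apply: IH.
  - by move=> i iJ; have := HJ _ iJ; rewrite mulSn; lia.
  - move=> i; rewrite in_fsetU => /orP[/HJ|]; first by rewrite mulSn; lia.
    by rewrite in_window => /andP[].
(* [W] ends just before (m + 1) k, where [J] may begin, so the two are disjoint and their sizes add
   up. *)
have -> : #|` (J `|` W)%fset| = (#|` J| + k)%N.
  rewrite cardfsU card_window.
  suff -> : (J `&` W)%fset = fset0 by rewrite cardfs0 subn0.
  apply/fsetP => i; rewrite in_fsetI in_fset0 in_window.
  by apply/negP => /andP[/HJ]; rewrite mulSn; lia.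
rewrite -EFinB; congr EFin; rewrite exprSr exprD; ring.
Qed.

Lemma prob_no_full_block (d : measure_display)
    (T : measurableType d) (R : realType) (P : probability T R) (p : R)
    (X : nat -> {RV P >-> R}) (hX : iid_bernoulli p X) (k m : nat) :
  P (no_full_block X k m) = ((1 - p ^+ k) ^+ m)%:E.
Proof.
have := @prob_no_full_block_all_success _ _ _ _ _ _ hX k m fset0.
rewrite cardfs0 expr0 mulr1 => <- //.
by rewrite /all_success set_fset0 bigcap_set0 setIT.
Qed.

(** * The longest run: measurability and tail bounds *)

Lemma longest_run_geP (R : realType) (T : Type) (X : nat -> T -> R)
    (n k : nat) (w : T) : (0 < k)%N ->
  (k <= longest_run X n w)%N <->
  exists l i : nat, [/\ (k <= l <= n)%N, (i <= n - l)%N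
    & \sum_(i <= j < i + l) X j w = l%:R].
Proof.
move=> k0; split => [kL|[l [i [/andP[kl ln] iln sumE]]]].
  pose A := [pred l : 'I_n.+1 | [exists i : 'I_n.+1, (i <= n - l)%N &&
           (\sum_(i <= k < i + l) X k w == l%:R)]].
  have A0 : (0 < #|A|)%N.
    apply/card_gt0P; exists ord0; apply/existsP; exists ord0 => /=.
    by rewrite big_geq.
  have [l lA Ll] := bigop.eq_bigmax_cond (@nat_of_ord n.+1) A0.
  have {}Ll : longest_run X n w = l by rewrite -Ll.
  move/existsP : lA => [i /andP[iln /eqP sumE]].
  by exists l, i; split => //; rewrite -Ll kL Ll -ltnS ltn_ord.
apply: (leq_trans kl).
have ln1 : (l < n.+1)%N by [].
have in1 : (i < n.+1)%N by rewrite ltnS (leq_trans iln)// leq_subr.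
apply: (@bigop.bigmax_sup _ (Ordinal ln1)) => //=.
by apply/existsP; exists (Ordinal in1) => /=; rewrite iln sumE eqxx.
Qed.

Lemma longest_run_ge_all_success (R : realType) (T : Type) (X : nat -> T -> R)
    (n k i : nat) (w : T) : (i + k <= n)%N ->
  all_success X (window i k) w -> (k <= longest_run X n w)%N.
Proof.
move=> ikn succ; have [->//|k0] := posnP k.
apply/longest_run_geP => //; exists k, i; split.
- by rewrite leqnn; lia.
- by lia.
- rewrite (eq_big_nat _ _ (F2 := fun=> 1)) => [|j ij].
    by rewrite sumr_const_nat addKn.
  by apply: succ => /=; rewrite in_window.
Qed.

Lemma measurable_longest_run_ge (d : measure_display) (T : measurableType d)
    (R : realType) (P : probability T R) (X : nat -> {RV P >-> R})
    (n k : nat) : measurable [set w | (k <= longest_run X n w)%N].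
Proof.
have [->|k0] := posnP k; first by rewrite (_ : mkset _ = setT)//; apply/seteqP.
rewrite (_ : mkset _ = \bigcup_(l in [set l | (k <= l <= n)%N])
   \bigcup_(i in [set i | (i <= n - l)%N])
     ((fun w => \sum_(i <= j < i + l) X j w) @^-1` [set l%:R])); last first.
  apply/seteqP; split => w /=.
    move/(longest_run_geP _ _ _ k0) => [l [i [kl il sumE]]].
    by exists l => //; exists i.
  by move=> [l kl [i il sumE]]; apply/longest_run_geP => //; exists l, i.
apply: bigcup_measurable => l _; apply: bigcup_measurable => i _.
rewrite -[X in measurable X]setTI.
by apply: measurable_sum.
Qed.

(** Each level set is a difference of two consecutive tail events, and there are countably many
    levels. Every event about L(n) used below, including those on the scale log n, is a preimage of
    this kind. *)
Lemma measurable_longest_run (d : measure_display) (T : measurableType d)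
    (R : realType) (P : probability T R) (X : nat -> {RV P >-> R})
    (n : nat) (B : set nat) : measurable (longest_run X n @^-1` B).
Proof.
rewrite (_ : _ @^-1` _ = \bigcup_(v in B)
  ([set w | (v <= longest_run X n w)%N] `\`
   [set w | (v < longest_run X n w)%N])).
  apply: bigcup_measurable => v _.
  by apply: measurableD; exact: measurable_longest_run_ge.
apply/seteqP; split => w /=.
  move=> BL; exists (longest_run X n w) => //=; split => //.
  by rewrite ltnn.
move=> [v Bv /= [vL /negP]]; rewrite -leqNgt => Lv.
by rewrite (_ : longest_run X n w = v)//; apply/eqP; rewrite eqn_leq Lv.
Qed.

(** If m disjoint blocks of length k fit into the first n trials, a longest run shorter than k
    leaves none of them full. *)
Lemma prob_longest_run_lt (d : measure_display) (T : measurableType d)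
    (R : realType) (P : probability T R) (p : R)
    (X : nat -> {RV P >-> R}) (hX : iid_bernoulli p X) (n k m : nat) :
  (m * k <= n)%N ->
  (P [set w | (longest_run X n w < k)%N] <= ((1 - p ^+ k) ^+ m)%:E)%E.
Proof.
move=> mkn; rewrite -(prob_no_full_block hX).
apply: le_measure; rewrite ?inE.
- exact: (measurable_longest_run X n [set v | (v < k)%N]).
- exact: measurable_no_full_block.
move=> w /= Lk; rewrite /no_full_block
  -(bigcap_mkord m (fun j => ~` all_success X (window (j * k) k))).
move=> j /= jm succ.
have jkn : (j * k + k <= n)%N.
  by rewrite addnC -mulSn (leq_trans _ mkn)// leq_mul2r jm orbT.
by have := longest_run_ge_all_success jkn succ; rewrite leqNgt Lk.
Qed.

(* Off this almost sure event, a sum of l trials may equal l without all of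
   them being 1. *)
Lemma ae_bernoulli_values (d : measure_display) (T : measurableType d)
    (R : realType) (P : probability T R) (p : R)
    (X : nat -> {RV P >-> R}) (hX : iid_bernoulli p X) :
  {ae P, forall w, forall i, X i w = 0 \/ X i w = 1}.
Proof.
have m1 i (x : R) : measurable (X i @^-1` [set x]).
  by rewrite -[Y in measurable Y]setTI; exact: measurable_funP.
apply: ae_foralln => i.
exists (~` (X i @^-1` [set 1] `|` X i @^-1` [set 0])); split.
- by apply: measurableC; apply: measurableU; exact: m1.
- apply: (etrans (probability_setC P _)).
    by apply: measurableU; exact: m1.
  have -> : P (X i @^-1` [set 1] `|` X i @^-1` [set 0]) = 1%E;
    last by rewrite subee.
  apply: (etrans (measureU P (m1 _ _) (m1 _ _) _)).
    by apply/seteqP; split => w //= [-> /eqP]; rewrite oner_eq0.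
  have [P1 P0] := hX.2 i.
  transitivity (p%:E + (1 - p)%:E)%E; last by rewrite -EFinD addrC subrK.
  by congr (_ + _)%E.
- by move=> w /= + [h|h]; apply; [right|left].
Qed.

(** The deficits 1 - x j are nonnegative and add up to 0, so each of them vanishes. *)
Lemma sum_indicators_full (R : realType) (x : nat -> R) (a l : nat) :
  (forall i, x i = 0 \/ x i = 1) -> \sum_(a <= j < a + l) x j = l%:R ->
  forall j, (a <= j < a + l)%N -> x j = 1.
Proof.
move=> x01 sumE j aj.
have : \sum_(a <= j < a + l) (1 - x j) = 0.
  by rewrite sumrB sumE sumr_const_nat addKn subrr.
rewrite big_nat_cond => /eqP.
rewrite psumr_eq0 => [/allP/(_ j)|i _]; last first.
  by case: (x01 i) => ->; rewrite ?subr0 ?subrr.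
rewrite mem_index_iota => /(_ aj); rewrite aj/= subr_eq0 => /eqP <- //.
Qed.

Lemma prob_longest_run_ge (d : measure_display) (T : measurableType d)
    (R : realType) (P : probability T R) (p : R)
    (X : nat -> {RV P >-> R}) (hX : iid_bernoulli p X) (n k : nat) :
  (0 < k)%N ->
  (P [set w | (k <= longest_run X n w)%N] <= (n.+1%:R * p ^+ k)%:E)%E.
Proof.
move=> k0; have [N [mN PN0 subN]] := ae_bernoulli_values hX.
(* All starting points up to n are allowed; the late windows reach past the first n trials, which
   only enlarges the union. *)
pose U := \big[setU/set0]_(i < n.+1) all_success X (window i k).
have mU : measurable U.
  by apply: bigsetU_measurable => i _; exact: measurable_all_success.
apply: (@le_trans _ _ (P (U `|` N))).
  apply: le_measure; rewrite ?inE.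
  - exact: measurable_longest_run_ge.
  - exact: measurableU.
  move=> w /= /(longest_run_geP _ _ _ k0)[l [i [/andP[kl ln] iln sumE]]].
  have [wN|wN] := pselect (N w); [by right|left].
  rewrite /U -(bigcup_mkord n.+1 (fun i => all_success X (window i k))).
  (* The run found has length l >= k, so its first k trials already fill the window at i. *)
  exists i => /=; first by lia.
  move=> j /=; rewrite in_window => ij.
  apply: (sum_indicators_full _ sumE); last by lia.
  by move=> r; apply: contrapT => h; apply/wN/subN => /= /(_ r).
rewrite measureU0//.
apply: (le_trans (Boole_inequality P
  (A := fun i => all_success X (window i k)) _)) => [i _|].
  exact: measurable_all_success.
rewrite (eq_bigr (fun=> (p ^+ k)%:E)) => [|i _]; last first.
  by apply: (etrans (prob_all_success hX _)); rewrite card_window.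
by rewrite sumEFin sumr_const card_ord mulr_natl.
Qed.

(** * Upper and lower limits on the exponential scale *)

Lemma limn_esup_le_near (R : realType) (u : (\bar R)^nat) (a : \bar R) :
  (\forall n \near \oo, (u n <= a)%E) -> (limn_esup u <= a)%E.
Proof.
move=> ua; apply: (@le_trans _ _ (ereal_sup (u @` [set n | (u n <= a)%E]))).
  by apply: ereal_inf_lbound; exists [set n | (u n <= a)%E].
by apply: ge_ereal_sup => _ [n /= un <-].
Qed.

Lemma limn_einf_ge_near (R : realType) (u : (\bar R)^nat) (a : \bar R) :
  (\forall n \near \oo, (a <= u n)%E) -> (a <= limn_einf u)%E.
Proof.
move=> au; rewrite /limn_einf leeNr; apply: limn_esup_le_near.
by apply: filterS au => n; rewrite leeN2.
Qed.

(** The constant K contributes ln K / s n, which is eventually below any e > 0. Values a n = 0 are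
    covered, since [lne] is monotone on [0, +oo]. *)
Lemma limn_esup_lne_le (R : realType) (s : nat -> R) (a : nat -> \bar R)
    (K A : R) : s @ \oo --> +oo -> 0 < K -> (forall n, 0 <= a n)%E ->
  (\forall n \near \oo, (a n <= (K * expR (- A * s n))%:E)%E) ->
  (limn_esup (fun n => ((s n)^-1)%:E * lne (a n)) <= (- A)%:E)%E.
Proof.
move=> soo K0 a0 aK; apply/lee_addgt0Pr => e e0; rewrite -EFinD.
apply: limn_esup_le_near; near=> n.
have s0 : 0 < s n by near: n; apply: cvgry_gt.
have sK : ln K / e <= s n by near: n; apply: cvgry_ge.
have an : (a n <= (K * expR (- A * s n))%:E)%E by near: n.
have {an} : (lne (a n) <= (ln K - A * s n)%:E)%E.
  have KA0 : 0 < K * expR (- A * s n) by rewrite mulr_gt0// expR_gt0.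
  rewrite -[ln K - _](_ : ln (K * expR (- A * s n)) = _); last first.
    by rewrite lnM ?posrE ?expR_gt0// expRK mulNr.
  by rewrite -lne_EFin// lee_lne// in_itv/= leey andbT// lee_fin ltW.
move=> /(lee_wpmul2l _) => /(_ (s n)^-1%:E) h.
apply: (le_trans (h _)); first by rewrite lee_fin invr_ge0 ltW.
rewrite -EFinM lee_fin ler_pdivrMl//.
move: sK; rewrite ler_pdivrMr// => sK; lra.
Unshelve. all: by end_near. Qed.

(** The loss e allowed in the exponent leaves room for subexponential factors such as 1 / log n, and
    disappears as e tends to 0. *)
Lemma limn_einf_lne_ge (R : realType) (s : nat -> R) (a : nat -> \bar R)
    (A : R) : s @ \oo --> +oo ->
  (forall e, 0 < e ->
    \forall n \near \oo, ((expR (- (A + e) * s n))%:E <= a n)%E) ->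
  ((- A)%:E <= limn_einf (fun n => ((s n)^-1)%:E * lne (a n)))%E.
Proof.
move=> soo aK; apply/lee_subgt0Pr => e e0; rewrite -EFinB.
have aKe := aK _ e0; apply: limn_einf_ge_near; near=> n.
have s0 : 0 < s n by near: n; apply: cvgry_gt.
have an : ((expR (- (A + e) * s n))%:E <= a n)%E by near: n.
have : ((- (A + e) * s n)%:E <= lne (a n))%E.
  rewrite -[X in X%:E]expRK -lne_EFin ?expR_gt0//.
  have e0' : (0 <= (expR (- (A + e) * s n))%:E)%E by rewrite lee_fin expR_ge0.
  by rewrite lee_lne// in_itv/= leey andbT// (le_trans e0').
move=> /(lee_wpmul2l _) => /(_ (s n)^-1%:E) h.
apply: (le_trans _ (h _)); last by rewrite lee_fin invr_ge0 ltW.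
by rewrite -EFinM lee_fin ler_pdivlMl//; lra.
Unshelve. all: by end_near. Qed.

(** * Elementary estimates *)

Lemma cvg_ln_natr (R : realType) : (fun n => ln n%:R : R) @ \oo --> +oo.
Proof.
apply/cvgryPge => B; near=> n.
have Bn : expR B <= n%:R by near: n; exact: nbhs_infty_ger.
by rewrite -ler_expR lnK// posrE (lt_le_trans _ Bn)// expR_gt0.
Unshelve. all: by end_near. Qed.

(** A cubic beats a quadratic: expR (e t) is the cube of expR (e t / 3), hence at least (e t / 3) ^
    3. The constant is 108 = 4 * 27, with 4 from (t + 1) ^ 2 <= 4 t ^ 2 and 27 from the cube of
    3. *)
Lemma poly_le_expR (R : realType) (e C t : R) : 0 < e -> 1 <= t ->
  108 * `|C| / e ^+ 3 <= t -> C * (t + 1) ^+ 2 <= expR (e * t).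
Proof.
move=> e0 t1; have e3 : 0 < e ^+ 3 by rewrite exprn_gt0.
rewrite ler_pdivrMr// => tC.
apply: (@le_trans _ _ ((e * t / 3) ^+ 3)); last first.
  rewrite [in leRHS](_ : e * t = 3%:R * (e * t / 3)); last by field.
  have et0 : 0 <= e * t / 3 by rewrite divr_ge0// mulr_ge0// ltW//; lra.
  rewrite expRM_natl lerXn2r ?nnegrE ?expR_ge0//.
  by apply: le_trans (expR_ge1Dx _); lra.
apply: (@le_trans _ _ (`|C| * (4 * t ^+ 2))).
  apply: (@le_trans _ _ (`|C| * (t + 1) ^+ 2)).
    by rewrite ler_wpM2r ?sqr_ge0 ?ler_norm.
  by rewrite ler_wpM2l//; nra.
rewrite (_ : (e * t / 3) ^+ 3 = (t * e ^+ 3) * t ^+ 2 / 27); last by field.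
have t2 : 0 <= t ^+ 2 by exact: sqr_ge0.
have := ler_wpM2r t2 tC; lra.
Qed.

Lemma near_poly_le_expR (R : realType) (e C : R) : 0 < e ->
  \forall n \near \oo, C * (ln n%:R + 1) ^+ 2 <= expR (e * ln n%:R).
Proof.
move=> e0; near=> n; apply: poly_le_expR => //.
  by near: n; exact/cvgry_ge/cvg_ln_natr.
by near: n; exact/cvgry_ge/cvg_ln_natr.
Unshelve. all: by end_near. Qed.

(** The product (1 - a) ^ m (1 + m a) starts at 1 and does not increase with m, because (1 - a) (1 +
    (m + 1) a) = 1 + m a - (m + 1) a ^ 2. *)
Lemma bernoulli_exprn_le (R : realType) (a : R) (m : nat) : 0 <= a <= 1 ->
  (1 - a) ^+ m <= (1 + m%:R * a)^-1.
Proof.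
move=> /andP[a0 a1]; rewrite -[leRHS]mul1r ler_pdivlMr; last first.
  by rewrite ltr_wpDr// mulr_ge0.
elim: m => [|m IH]; first by rewrite expr0 mul0r addr0 mulr1.
apply: le_trans IH; rewrite exprSr -mulrA ler_wpM2l ?exprn_ge0 ?subr_ge0//.
rewrite -natr1; have : 0 <= m%:R * a ^+ 2 :> R by rewrite mulr_ge0// sqr_ge0.
nra.
Qed.

Lemma invD1_le_half (R : realType) (u : R) :
  0 <= u <= 1 -> (1 + u)^-1 <= 1 - u / 2.
Proof.
move=> /andP[u0 u1]; rewrite -[leLHS]div1r ler_pdivrMr; last by lra.
by nra.
Qed.

Lemma onem_exprn_le_expR (R : realType) (a : R) (m : nat) : 0 <= a <= 1 ->
  (1 - a) ^+ m <= expR (- (m%:R * a)).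
Proof.
move=> /andP[a0 a1]; rewrite -mulrN expRM_natl.
by rewrite lerXn2r ?nnegrE ?subr_ge0 ?expR_ge0// expR_ge1Dx.
Qed.

(** With q = n %/ k >= 1 one has n < (q + 1) k <= 2 q k. *)
Lemma half_le_divn (R : realType) (n k : nat) : (0 < k <= n)%N ->
  n%:R / (2 * k%:R) <= (n %/ k)%:R :> R.
Proof.
move=> /andP[k0 kn]; rewrite ler_pdivrMr ?mulr_gt0 ?ltr0n//.
rewrite -[2]/(2%:R) -!natrM ler_nat.
have := divn_eq n k; have := ltn_pmod n k0.
have : (0 < n %/ k)%N by rewrite divn_gt0.
nia.
Qed.

(** * Powers of [p] compared with powers of n, where t = ln n *)

Lemma ln_inv_gt0 (R : realType) (p : R) (p01 : 0 < p < 1) : 0 < ln (1 / p).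
Proof. by move/andP: p01 => [p0 p1]; rewrite ln_gt0// div1r invf_gt1. Qed.

Lemma exprn_expR (R : realType) (p : R) (p01 : 0 < p < 1) (k : nat) :
  p ^+ k = expR (- (k%:R * ln (1 / p))).
Proof.
move/andP: p01 => [p0 p1].
by rewrite div1r lnV ?posrE// mulrN opprK expRM_natl lnK// posrE.
Qed.

Lemma exprn_le_expR (R : realType) (p : R) (p01 : 0 < p < 1) (x t : R)
    (k : nat) : x * (t / ln (1 / p)) <= k%:R ->
  p ^+ k <= expR (- (x * t)).
Proof.
have l0 := ln_inv_gt0 p01.
by rewrite mulrA ler_pdivrMr// (exprn_expR p01) ler_expR lerN2.
Qed.

(** Rounding the exponent up by at most 1 costs at most one factor [p]. *)
Lemma exprn_ge_expR (R : realType) (p : R) (p01 : 0 < p < 1) (x t : R)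
    (k : nat) : k%:R <= x * (t / ln (1 / p)) + 1 ->
  p * expR (- (x * t)) <= p ^+ k.
Proof.
have l0 := ln_inv_gt0 p01; move=> kx.
have -> : p * expR (- (x * t)) =
    expR (- ((x * (t / ln (1 / p)) + 1) * ln (1 / p))).
  rewrite -[X in X * _](expr1 p) (exprn_expR p01) -expRD; congr expR.
  by move: (ln _) l0 => l l0; field; rewrite gt_eqF.
by rewrite (exprn_expR p01) ler_expR lerN2 ler_wpM2r// ltW.
Qed.


Lemma logb_cvg (R : realType) (p : R) (p01 : 0 < p < 1) :
  (fun n => logb (1 / p) n%:R) @ \oo --> +oo.
Proof.
apply/cvgryPge => B; near=> n; rewrite /logb ler_pdivlMr ?ln_inv_gt0//.
by near: n; exact/cvgry_ge/cvg_ln_natr.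
Unshelve. all: by end_near. Qed.

(** * Probabilities of L(n) on the scale log n *)

(** The probability is at least 1 - P(L(n) < k) - P(L(n) >= k') for suitable k < k'. The loss b in
    the exponent pays for the factor 1 / k of the block count, and b <= e keeps the upper tail
    comparable with the target n ^ (1 - x - b). *)
Lemma prob_longest_run_window (d : measure_display) (T : measurableType d)
    (R : realType) (P : probability T R) (p : R) (hp : 0 < p < 1)
    (X : nat -> {RV P >-> R}) (hX : iid_bernoulli p X) (x e b : R) :
  1 <= x -> 0 < b <= e -> \forall n \near \oo,
  ((expR ((1 - x - b) * ln n%:R))%:E <=
   P [set w | x * logb (1 / p) n%:R < (longest_run X n w)%:R
                <= (x + e) * logb (1 / p) n%:R]%R)%E.
Proof.
move=> x1 /andP[b0 be].
have l0 := ln_inv_gt0 hp.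
have /andP[p0 p1] := hp.
near=> n.
have n0 : (0 < n)%N by near: n; exact: nbhs_infty_gt.
have Hn : (x / ln (1 / p) + 1) * (ln n%:R + 1) ^+ 2 <= expR (1 * ln n%:R).
  by near: n; exact: near_poly_le_expR.
(* The 12 is 3 * 2 * 2: three copies of the target [E1], the 2 of [half_le_divn], and the 2 of u /
   2. *)
have Hb : 12 / p * (x / ln (1 / p) + 1) * (ln n%:R + 1) ^+ 2 <=
    expR (b * ln n%:R).
  by near: n; exact: near_poly_le_expR.
rewrite /logb; move: Hn Hb; set t := ln n%:R; set s := t / ln (1 / p).
move=> Hn Hb.
have t0 : 0 <= t by apply: ln_ge0; rewrite ler1n.
have nE : n%:R = expR t by rewrite lnK// posrE ltr0n.
have s0 : 0 <= s by rewrite divr_ge0// ltW.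
have xs0 : 0 <= x * s by rewrite mulr_ge0//; lra.
have xes0 : 0 <= (x + e) * s by rewrite mulr_ge0//; lra.
(* These are the least integers strictly above x s and (x + e) s, so k <= L(n) < k' says exactly x s
   < L(n) <= (x + e) s. *)
pose k := (Num.truncn (x * s)).+1; pose k' := (Num.truncn ((x + e) * s)).+1.
have kgt : x * s < k%:R by exact: truncnS_gt.
have k'gt : (x + e) * s < k'%:R by exact: truncnS_gt.
have kle : k%:R <= x * s + 1 by rewrite -natr1 lerD2r truncn_le.
have kC : k%:R <= (x / ln (1 / p) + 1) * (t + 1) ^+ 2.
  apply: (le_trans kle).
  have xl0 : 0 <= x / ln (1 / p) by rewrite divr_ge0//; lra.
  rewrite (_ : x * s = x / ln (1 / p) * t); last by rewrite mulrCA mulrC.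
  have := mulr_ge0 xl0 t0; have := mulr_ge0 xl0 (sqr_ge0 t).
  by have := sqr_ge0 t; lra.
have kn : (k <= n)%N.
  by rewrite -(ler_nat R) nE (le_trans kC)// -[t in expR t]mul1r.
pose m := (n %/ k)%N; pose a := p ^+ k.
have mkn : (m * k <= n)%N by exact: leq_trunc_div.
have a01 : 0 <= a <= 1 by rewrite exprn_ge0 ?exprn_ile1// ltW.
have aU : a <= expR (- (x * t)) by apply: exprn_le_expR => //; exact: ltW.
have aL : p * expR (- (x * t)) <= a by exact: exprn_ge_expR.
pose G := expR t * expR (- (x * t)).
pose u := m%:R * a.
(* Here x >= 1 enters: m p ^ k <= n * n ^ (- x) <= 1, as [invD1_le_half] requires. *)
have u1 : 0 <= u <= 1.
  have /andP[a0 _] := a01; rewrite mulr_ge0//=.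
  apply: (@le_trans _ _ G).
    by apply: ler_pM => //; rewrite -nE ler_nat leq_div.
  rewrite /G -expRD -expR0 ler_expR.
  have x10 : 0 <= x - 1 by rewrite subr_ge0.
  by have := mulr_ge0 x10 t0; lra.
pose E1 := expR ((1 - x - b) * t).
have E1E : E1 * expR (b * t) = G.
  by rewrite /E1 /G -!expRD; congr expR; ring.
have uL : 3 * E1 <= u / 2.
  have k0 : 0 < k%:R :> R by rewrite ltr0n.
  have h1 : expR t / (2 * k%:R) <= m%:R by rewrite -nE; exact: half_le_divn.
  have h2 : 12 * k%:R <= p * expR (b * t).
    have : 12 * k%:R <= 12 * ((x / ln (1 / p) + 1) * (t + 1) ^+ 2) by lra.
    move=> /le_trans; apply; rewrite -ler_pdivrMl//.
    by apply: le_trans Hb; rewrite le_eqVlt; apply/orP/or_introl/eqP; ring.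
  have h3 : p * G / (2 * k%:R) <= u.
    rewrite /G mulrCA mulrAC; apply: ler_pM => //.
    by rewrite mulr_ge0 ?expR_ge0// ltW.
  suff : 3 * E1 <= p * G / (2 * k%:R) / 2 by lra.
  rewrite -E1E -mulrA -invfM ler_pdivlMr ?mulr_gt0//.
  have := ler_wpM2l (expR_ge0 ((1 - x - b) * t)) h2; rewrite -/E1; lra.
have Pup : n.+1%:R * p ^+ k' <= 2 * E1.
  have h : p ^+ k' <= expR (- ((x + e) * t)).
    by apply: exprn_le_expR => //; exact: ltW.
  apply: (@le_trans _ _ ((2 * expR t) * expR (- ((x + e) * t)))).
    apply: ler_pM; rewrite ?exprn_ge0//; first exact: ltW.
    by rewrite -natr1 -nE mulr_natl mulr2n lerD2l ler1n.
  rewrite -mulrA ler_wpM2l// -expRD ler_expR.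
  have eb0 : 0 <= e - b by rewrite subr_ge0.
  by have := mulr_ge0 eb0 t0; generalize t; clear=> r ?; lra.
have Plo : (1 - a) ^+ m <= 1 - u / 2.
  exact: (le_trans (bernoulli_exprn_le _ a01) (invD1_le_half u1)).
set E := mkset _.
have mE : measurable E.
  exact: (measurable_longest_run X n
    [set v | x * s < v%:R <= (x + e) * s]).
pose C := [set w | (longest_run X n w < k)%N].
pose B := [set w | (k' <= longest_run X n w)%N].
have mC : measurable C.
  exact: (measurable_longest_run X n [set v | (v < k)%N]).
have mB : measurable B by exact: measurable_longest_run_ge.
have cover : setT `<=` E `|` (C `|` B).
  move=> w _; have [Lk|kL] := ltnP (longest_run X n w) k; first by right; left.
  have [k'L|Lk'] := leqP k' (longest_run X n w); first by right; right.
  left; apply/andP; split.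
    by apply: (lt_le_trans kgt); rewrite ler_nat.
  by rewrite -truncn_ge_nat// -ltnS.
have : (1 <= P E + (P C + P B))%E.
  rewrite -(@probability_setT _ _ _ P).
  apply: (@le_trans _ _ (P (E `|` (C `|` B)))).
    by apply: le_measure; rewrite ?inE//; do ?apply: measurableU.
  apply: (le_trans (measureU2 P _ _)) => //; first exact: measurableU.
  by apply: leeD2l; exact: measureU2.
have PC : (P C <= (1 - u / 2)%:E)%E.
  by apply: (le_trans (prob_longest_run_lt hX mkn)); rewrite lee_fin.
have PB : (P B <= (2 * E1)%:E)%E.
  by apply: (le_trans (prob_longest_run_ge hX n (ltn0Sn _))); rewrite lee_fin.
(* What remains for [E] is u / 2 - 2 [E1] >= 3 [E1] - 2 [E1] = [E1]. *)
move=> P1; have {P1} : (1 <= P E + (1 - u / 2 + 2 * E1)%:E)%E.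
  by apply: (le_trans P1); apply: leeD2l; rewrite EFinD; exact: leeD.
rewrite -leeBlDr// => /(le_trans _); apply.
rewrite -EFinB lee_fin -/E1; move: uL; generalize E1 u; clear=> v w ?; lra.
Unshelve. all: by end_near. Qed.

(** Since y is arbitrary, the lower tail is below every power of n. This y will be matched with the
    one of the upper tail. *)
Lemma prob_longest_run_small (d : measure_display) (T : measurableType d)
    (R : realType) (P : probability T R) (p : R) (hp : 0 < p < 1)
    (X : nat -> {RV P >-> R}) (hX : iid_bernoulli p X) (e y : R) :
  0 < e <= 1 -> 1 <= y -> \forall n \near \oo,
  (P [set w | (longest_run X n w)%:R <= (1 - e) * logb (1 / p) n%:R]%R <=
   (expR ((1 - y) * ln n%:R))%:E)%E.
Proof.
move=> /andP[e0 e1] y1.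
have l0 := ln_inv_gt0 hp.
have /andP[p0 p1] := hp.
near=> n.
have n0 : (0 < n)%N by near: n; exact: nbhs_infty_gt.
have Hn : (1 / ln (1 / p) + 1) * (ln n%:R + 1) ^+ 2 <= expR (1 * ln n%:R).
  by near: n; exact: near_poly_le_expR.
have He : (y - 1) * 2 / p * (1 / ln (1 / p) + 1) * (ln n%:R + 1) ^+ 2 <=
    expR (e * ln n%:R).
  by near: n; exact: near_poly_le_expR.
rewrite /logb; move: Hn He; set t := ln n%:R; set s := t / ln (1 / p).
move=> Hn He.
have t0 : 0 <= t by apply: ln_ge0; rewrite ler1n.
have nE : n%:R = expR t by rewrite lnK// posrE ltr0n.
have s0 : 0 <= s by rewrite divr_ge0// ltW.
have es0 : 0 <= (1 - e) * s by rewrite mulr_ge0// subr_ge0.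
pose k := (Num.truncn ((1 - e) * s)).+1.
have kgt : (1 - e) * s < k%:R by exact: truncnS_gt.
have kle : k%:R <= (1 - e) * s + 1 by rewrite -natr1 lerD2r truncn_le.
(* Only one factor ln n + 1 is spent on the block length; the second one in [He] pays for the ln n
   in the exponent (y - 1) ln n. *)
pose Q := (1 / ln (1 / p) + 1) * (t + 1).
have Q0 : 0 <= Q by rewrite mulr_ge0// ?addr_ge0// divr_ge0// ltW.
have kQ : k%:R <= Q.
  apply: (le_trans kle); apply: (@le_trans _ _ (s + 1)).
    by rewrite lerD2r ler_piMl// lerBlDr lerDl ltW.
  rewrite /Q (_ : s = 1 / ln (1 / p) * t); last by rewrite mul1r mulrC.
  have : 0 <= 1 / ln (1 / p) by rewrite divr_ge0// ltW.
  by move: t0; generalize t (1 / ln (1 / p)); clear=> u v u0 v0; nra.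
have kn : (k <= n)%N.
  rewrite -(ler_nat R) nE (le_trans kQ)// -[t in expR t]mul1r.
  by apply: le_trans Hn; rewrite /Q expr2 mulrA ler_peMr// lerDr.
pose m := (n %/ k)%N; pose a := p ^+ k.
have mkn : (m * k <= n)%N by exact: leq_trunc_div.
have a01 : 0 <= a <= 1 by rewrite exprn_ge0 ?exprn_ile1// ltW.
have aL : p * expR (- ((1 - e) * t)) <= a by exact: exprn_ge_expR.
(* The right-hand side is at least n / (2 k) * p n ^ (e - 1) = p n ^ e / (2 k). *)
have maL : (y - 1) * t <= m%:R * a.
  have k0 : 0 < k%:R :> R by rewrite ltr0n.
  have h1 : expR t / (2 * k%:R) <= m%:R by rewrite -nE; exact: half_le_divn.
  have h2 : (y - 1) * t * (2 * k%:R) <= p * expR (e * t).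
    rewrite -ler_pdivrMl//; apply: le_trans He.
    rewrite [leLHS](_ : _ = (y - 1) * 2 / p * (t * k%:R)); last by ring.
    rewrite -[leRHS]mulrA ler_wpM2l//.
      by rewrite divr_ge0 ?mulr_ge0 ?subr_ge0// ltW.
    rewrite expr2 mulrCA; by apply: ler_pM => //; rewrite lerDl.
  apply: (@le_trans _ _ (expR t / (2 * k%:R) * (p * expR (- ((1 - e) * t))))).
    rewrite mulrAC ler_pdivlMr ?mulr_gt0//; apply: (le_trans h2).
    by rewrite mulrCA -expRD ler_pM2l// ler_expR le_eqVlt;
       apply/orP/or_introl/eqP; ring.
  by apply: ler_pM => //; rewrite mulr_ge0 ?expR_ge0// ltW.
apply: (@le_trans _ _ (P [set w | (longest_run X n w < k)%N])).
  apply: le_measure; rewrite ?inE.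
  - exact: (measurable_longest_run X n [set v | v%:R <= (1 - e) * s]).
  - exact: (measurable_longest_run X n [set v | (v < k)%N]).
  - by move=> w /=; rewrite ltnS truncn_ge_nat.
apply: (le_trans (prob_longest_run_lt hX mkn)); rewrite lee_fin.
apply: (le_trans (onem_exprn_le_expR _ a01)).
by rewrite ler_expR -opprB mulNr lerN2.
Unshelve. all: by end_near. Qed.

(** In the constant, 2 comes from n + 1 <= 2 n and 1 / p from rounding y log n down to an
    integer. *)
Lemma prob_longest_run_large (d : measure_display) (T : measurableType d)
    (R : realType) (P : probability T R) (p : R) (hp : 0 < p < 1)
    (X : nat -> {RV P >-> R}) (hX : iid_bernoulli p X) (y : R) :
  1 <= y -> \forall n \near \oo,
  (P [set w | y * logb (1 / p) n%:R <= (longest_run X n w)%:R]%R <=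
   (2 / p * expR ((1 - y) * ln n%:R))%:E)%E.
Proof.
move=> y1.
have l0 := ln_inv_gt0 hp.
have /andP[p0 p1] := hp.
near=> n.
have n0 : (0 < n)%N by near: n; exact: nbhs_infty_gt.
(* This keeps the rounded length [k] positive, as the union bound demands. *)
have s1 : 1 <= logb (1 / p) n%:R by near: n; exact/cvgry_ge/logb_cvg.
move: s1; rewrite /logb; set t := ln n%:R; set s := t / ln (1 / p) => s1.
have nE : n%:R = expR t by rewrite lnK// posrE ltr0n.
have ys1 : 1 <= y * s.
  by apply: (le_trans s1); rewrite ler_peMl// (le_trans ler01).
pose k := Num.truncn (y * s).
have k0 : (0 < k)%N by rewrite truncn_gt0.
have pk : p ^+ k <= p^-1 * expR (- (y * t)).
  rewrite -ler_pdivrMl ?invr_gt0// invrK -exprS.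
  by apply: exprn_le_expR => //; apply: ltW; exact: truncnS_gt.
apply: (@le_trans _ _ (P [set w | (k <= longest_run X n w)%N])).
  apply: le_measure; rewrite ?inE.
  - exact: (measurable_longest_run X n [set v | y * s <= v%:R]).
  - exact: measurable_longest_run_ge.
  - move=> w /= yL; rewrite -(ler_nat R); apply: le_trans yL.
    by rewrite truncn_le (le_trans _ ys1).
apply: (le_trans (prob_longest_run_ge hX n k0)); rewrite lee_fin.
apply: (@le_trans _ _ ((2 * expR t) * (p^-1 * expR (- (y * t))))).
  apply: ler_pM => //; first by rewrite exprn_ge0// ltW.
  by rewrite -natr1 -nE mulr_natl mulr2n lerD2l ler1n.
rewrite mulrACA -expRD ler_wpM2l//; first by rewrite divr_ge0// ltW.
by rewrite ler_expR mulrBl mul1r.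
Unshelve. all: by end_near. Qed.

(** * The rate function and the two large deviation bounds *)

Lemma good_rate_function_run_rate (R : realType) (p : R) (p01 : 0 < p < 1) :
  good_rate_function (run_rate p).
Proof.
have l0 := ln_inv_gt0 p01.
split.
- move=> x; rewrite /run_rate; case: ltP => // x1.
  by rewrite lee_fin mulr_ge0 ?subr_ge0// ltW.
- move=> x a; rewrite /run_rate; case: (ltP x 1) => [x1 _|x1].
    exists [set y | y < 1].
      by apply: open_nbhs_nbhs; split => //; exact: open_lt.
    by move=> y /= ->; rewrite ltry.
  rewrite lte_fin -ltr_pdivrMr// ltrBrDl => ax.
  (* For negative a this half-line reaches left of 1, where the rate is infinite and hence still
     above a. *)
  exists [set y | 1 + a / ln (1 / p) < y].
    by apply: open_nbhs_nbhs; split => //; exact: open_gt.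
  move=> y /= ay; case: (ltP y 1) => _; first exact: ltry.
  by rewrite lte_fin -ltr_pdivrMr// ltrBrDl.
- move=> c c0; rewrite (_ : mkset _ = `[1, 1 + c / ln (1 / p)]%classic).
    exact: segment_compact.
  apply/seteqP; split => x /=; rewrite in_itv/= /run_rate; case: ltP => // x1.
  + by rewrite lee_fin -ler_pdivlMr// lerBlDl.
  + by rewrite lee_fin -ler_pdivlMr// lerBlDl.
Qed.

Lemma run_rate_lower_bound (d : measure_display) (T : measurableType d)
    (R : realType) (P : probability T R) (p : R) (hp : 0 < p < 1)
    (X : nat -> {RV P >-> R}) (hX : iid_bernoulli p X) (O : set R) (x : R) :
  open O -> O x ->
  (- run_rate p x <= limn_einf (fun n => ((logb (1 / p) n%:R)^-1)%:E *
     lne (P ((fun w => (longest_run X n w)%:R / logb (1 / p) n%:R)%R @^-1` O)))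
   )%E.
Proof.
move=> oO Ox; have l0 := ln_inv_gt0 hp.
rewrite /run_rate; case: ltP => x1; first exact: leNye.
apply: limn_einf_lne_ge => [|h h0]; first exact: logb_cvg.
have /nbhs_ballP[r /= r0 xrO] : nbhs x O by exact: open_nbhs_nbhs.
(* Halving r puts the closed end x + e inside the open ball; h / ln (1 / p) is the loss h converted
   from multiples of log_{1/p} n to multiples of ln n. *)
pose e := r / 2; pose b := Num.min (h / ln (1 / p)) e.
have e0 : 0 < e by rewrite divr_gt0.
have b0 : 0 < b <= e by rewrite lt_min divr_gt0//= e0 ge_min lexx orbT.
have win := prob_longest_run_window hp hX x1 b0.
near=> n.
have n0 : (0 < n)%N by near: n; exact: nbhs_infty_gt.
have s0 : 0 < logb (1 / p) n%:R by near: n; exact/cvgry_gt/logb_cvg.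
have t0 : 0 <= ln n%:R :> R by apply: ln_ge0; rewrite ler1n.
have : ((expR ((1 - x - b) * ln n%:R))%:E <=
   P [set w | x * logb (1 / p) n%:R < (longest_run X n w)%:R
                <= (x + e) * logb (1 / p) n%:R]%R)%E by near: n.
move=> winn; apply: (@le_trans _ _ (expR ((1 - x - b) * ln n%:R))%:E).
  rewrite lee_fin ler_expR.
  have -> : - ((x - 1) * ln (1 / p) + h) * logb (1 / p) n%:R =
            (1 - x - h / ln (1 / p)) * ln n%:R.
    rewrite /logb; move: (ln (1 / p)) l0 => l l0'; field.
    by rewrite gt_eqF.
  by rewrite ler_wpM2r// lerD2l lerN2 ge_min lexx.
apply: (le_trans winn); apply: le_measure; rewrite ?inE.
- exact: (measurable_longest_run X n
    [set v | x * logb (1 / p) n%:R < v%:R <= (x + e) * logb (1 / p) n%:R]).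
- exact: (measurable_longest_run X n [set v | O (v%:R / logb (1 / p) n%:R)]).
move=> w /= /andP[Lx Le]; apply: xrO; rewrite /ball/= ltr_distlC.
rewrite ltr_pdivlMr// ltr_pdivrMr//; apply/andP; split.
  by apply: le_lt_trans Lx; rewrite ler_pM2r// gerBl ltW.
apply: (le_lt_trans Le); rewrite ltr_pM2r// ltrD2l.
by rewrite /e ltr_pdivrMr// ltr_pMr// ltr1n.
Unshelve. all: by end_near. Qed.

(** If A > 0, then [F] avoids the zero 1 of the rate, and being closed it avoids a neighbourhood of
    1. So [F] lies in the union of a half-line ending below 1 and the half-line from y = 1 + A / ln
    (1 / p), where the rate equals A. *)
Lemma run_rate_upper_bound (d : measure_display) (T : measurableType d)
    (R : realType) (P : probability T R) (p : R) (hp : 0 < p < 1)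
    (X : nat -> {RV P >-> R}) (hX : iid_bernoulli p X) (F : set R) (A : R) :
  closed F -> 0 <= A -> (forall x, F x -> (A%:E <= run_rate p x)%E) ->
  (limn_esup (fun n => ((logb (1 / p) n%:R)^-1)%:E *
     lne (P ((fun w => (longest_run X n w)%:R / logb (1 / p) n%:R)%R @^-1` F)))
   <= (- A)%:E)%E.
Proof.
move=> cF A0 FA; have l0 := ln_inv_gt0 hp.
have /andP[p0 p1] := hp.
have mF n : measurable
    ((fun w => (longest_run X n w)%:R / logb (1 / p) n%:R)%R @^-1` F).
  exact: (measurable_longest_run X n [set v | F (v%:R / logb (1 / p) n%:R)]).
(* The 1 is the constant of the lower tail and 2 / p that of the upper tail. *)
have K0 : 0 < 1 + 2 / p by rewrite addr_gt0// divr_gt0.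
apply: (limn_esup_lne_le (logb_cvg hp) K0) => [n|]; first exact: measure_ge0.
(* For A = 0 there may be no gap around 1, but then a probability being at most 1 suffices. *)
move: A0; rewrite le_eqVlt => /predU1P[A0|A0].
  apply: nearW => n; rewrite -A0 oppr0 mul0r expR0 mulr1.
  apply: (le_trans (probability_le1 P (mF n))).
  by rewrite lee_fin lerDl divr_ge0// ltW.
have F1 : ~ F 1.
  by move=> /FA; rewrite /run_rate ltxx subrr mul0r lee_fin leNgt A0.
have /nbhs_ballP[r /= r0 rF] : nbhs (1 : R) (~` F).
  by apply: open_nbhs_nbhs; split => //; exact: closed_openC.
pose e := Num.min r 1; pose y := 1 + A / ln (1 / p).
have e01 : 0 < e <= 1 by rewrite lt_min r0 ltr01 ge_min lexx orbT.
have y1 : 1 <= y by rewrite lerDl divr_ge0// ltW.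
have Fcase x : F x -> x <= 1 - e \/ y <= x.
  move=> Fx; have [x1|x1] := ltP x 1; last first.
    right; have := FA _ Fx; rewrite /run_rate ltNge x1/= lee_fin.
    by rewrite -ler_pdivrMr// lerBrDl.
  left; rewrite leNgt; apply/negP => xe; apply: (rF x) => //.
  rewrite /ball/= ltr_distlC; apply/andP; split.
    by apply: le_lt_trans xe; rewrite lerD2l lerN2 ge_min lexx.
  by rewrite (lt_le_trans x1)// lerDl ltW.
have small := prob_longest_run_small hp hX e01 y1.
have large := prob_longest_run_large hp hX y1.
near=> n.
have s0 : 0 < logb (1 / p) n%:R by near: n; exact/cvgry_gt/logb_cvg.
have : (P [set w | (longest_run X n w)%:R <= (1 - e) * logb (1 / p) n%:R]%R <=
   (expR ((1 - y) * ln n%:R))%:E)%E by near: n.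
have : (P [set w | y * logb (1 / p) n%:R <= (longest_run X n w)%:R]%R <=
   (2 / p * expR ((1 - y) * ln n%:R))%:E)%E by near: n.
set S2 := mkset _; set S1 := mkset _ => P2 P1.
have mS1 : measurable S1.
  exact: (measurable_longest_run X n
    [set v | v%:R <= (1 - e) * logb (1 / p) n%:R]).
have mS2 : measurable S2.
  exact: (measurable_longest_run X n [set v | y * logb (1 / p) n%:R <= v%:R]).
apply: (@le_trans _ _ (P (S1 `|` S2))).
  apply: le_measure; rewrite ?inE//; first exact: measurableU.
  by move=> w /= /Fcase[]; rewrite ?ler_pdivrMr ?ler_pdivlMr//; [left|right].
apply: (le_trans (measureU2 P mS1 mS2)); apply: (le_trans (leeD P1 P2)).
have -> : - A * logb (1 / p) n%:R = (1 - y) * ln n%:R.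
  by rewrite /y /logb; ring.
by rewrite -EFinD lee_fin [leRHS]mulrDl mul1r.
Unshelve. all: by end_near. Qed.

Theorem corollary1 (R : realType) (d : measure_display) (T : measurableType d)
    (P : probability T R) (p : R) (hp : 0 < p < 1)
    (X : nat -> {RV P >-> R}) (hX : iid_bernoulli p X) :
  satisfies_LDP P
    (fun n w => (longest_run X n w)%:R / logb (1 / p) n%:R)
    (fun n => logb (1 / p) n%:R)
    (run_rate p).
Proof.
have rate := good_rate_function_run_rate hp.
split => //.
- move=> O oO; rewrite leeNl; apply/ereal_infP => _ [x Ox <-].
  by rewrite leeNl; exact: run_rate_lower_bound.
- move=> F cF; set I := ereal_inf _.
  have I0 : (0 <= I)%E.
    by apply/ereal_infP => _ [x _ <-]; have [+ _ _] := rate; exact.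
  (* Stated for finite A below the infimum, since the infimum itself may be +oo. *)
  have upper A : 0 <= A -> (A%:E <= I)%E -> (limn_esup (fun n =>
      ((logb (1 / p) n%:R)^-1)%:E * lne (P ((fun w =>
        (longest_run X n w)%:R / logb (1 / p) n%:R)%R @^-1` F))) <= (- A)%:E)%E.
    move=> A0 AI; apply: run_rate_upper_bound => // x Fx.
    by apply: (le_trans AI); apply: ereal_inf_lbound; exists x.
  move: I0 upper; case: I => [r|_|]; rewrite ?lee_fin//.
    by move=> r0 /(_ r r0 (lexx _)).
  (* With an infinite infimum every r > 0 is admissible, which forces the upper limit to be -oo. *)
  move=> upper; rewrite leeNr leye_eq; apply/eqP/eqyP => r r0.
  by rewrite leeNr; exact: (upper r (ltW r0) (leey _)).
Qed.
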